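(* For any two integers $c$ and $p$ such that $c\geq 1$ and $0\leq p\leq c-1$, there exists a perfect graph $G$ with $\chi(G)=c$ and $\varphi(G)=p$. Similarly, for any two integers $c$ and $p$ such that $c\geq 2$ and $0\leq p\leq c-2$, there exists a perfect graph $G$ with $\chi(G)=c$ and $\hat{\varphi}(G)=p$.
   Context: All graphs are finite, simple and undirected, with at least one vertex. $\chi$ denotes the chromatic number. For a proper vertex coloring $r$ of $G$ and an induced subgraph $H$ of $G$, let $r(H)$ be the set of colors used by $r$ on the vertices of $H$. Define $\varphi_r(G)=\max_{H}\,(|r(H)|-\chi(H))$ over all induced subgraphs $H$ of $G$, and $\hat{\varphi}_r(G)$ as the same maximum taken only over all connected induced subgraphs $H$ of $G$. Define $\varphi(G)=\min_r \varphi_r(G)$ and $\hat{\varphi}(G)=\min_r \hat{\varphi}_r(G)$, the minima over all proper colorings $r$ of $G$ (with any number of colors). A graph is perfect if every induced subgraph has chromatic number equal to its clique number. *)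

(* Defs.v *)
From mathcomp Require Import all_boot.

Set Implicit Arguments.
Unset Strict Implicit.
Unset Printing Implicit Defensive.

(* A graph may have no vertices here, so that [induced] is total; nonemptiness
   is required explicitly wherever graphs or subgraphs are quantified over. *)
Record sgraph := SGraph {
  vertex :> finType;
  edge : rel vertex;
  edge_sym : symmetric edge;
  edge_irrefl : irreflexive edge }.

Section Induced.
Variables (G : sgraph) (A : {set G}).

Definition induced_edge : rel {x : G | x \in A} :=
  fun x y => edge (val x) (val y).

Lemma induced_edge_sym : symmetric induced_edge.
Proof. by move=> x y; rewrite /induced_edge edge_sym. Qed.

Lemma induced_edge_irrefl : irreflexive induced_edge.
Proof. by move=> x; rewrite /induced_edge edge_irrefl. Qed.

Definition induced : sgraph := SGraph induced_edge_sym induced_edge_irrefl.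

End Induced.

Definition proper_coloring (G : sgraph) (C : eqType) (r : G -> C) : bool :=
  [forall x, forall y, edge x y ==> (r x != r y)].

Definition colorable (G : sgraph) (k : nat) : bool :=
  [exists r : {ffun G -> 'I_k}, proper_coloring r].

Lemma colorable_exists (G : sgraph) : exists k, colorable G k.
Proof.
exists #|G|; apply/existsP; exists [ffun x => enum_rank x].
apply/forallP=> x; apply/forallP=> y; apply/implyP=> exy; rewrite !ffunE.
by apply: contraTneq exy => /enum_rank_inj ->; rewrite edge_irrefl.
Qed.

Definition chi (G : sgraph) : nat := ex_minn (colorable_exists G).

Definition clique (G : sgraph) (K : {set G}) : bool :=
  [forall x in K, forall y in K, (x != y) ==> edge x y].

Definition omega (G : sgraph) : nat := \max_(K : {set G} | clique K) #|K|.

Definition perfect (G : sgraph) : Prop :=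
  forall A : {set G}, A != set0 -> chi (induced A) = omega (induced A).

Definition connected (G : sgraph) : bool :=
  (0 < #|G|) && [forall x : G, forall y : G, connect (@edge G) x y].

Definition ncolors (G : sgraph) (C : eqType) (r : G -> C) (A : {set G}) : nat :=
  size (undup [seq r x | x in A]).

(* Hence the truncated subtractions below are genuine ones. *)
Lemma chi_le_ncolors (G : sgraph) (C : eqType) (r : G -> C) (A : {set G}) :
  proper_coloring r -> chi (induced A) <= ncolors r A.
Proof.
move=> /forallP pr; rewrite /chi; case: ex_minnP => k _; apply.
have rA (x : induced A) : index (r (val x)) (undup [seq r x | x in A])
    < ncolors r A.
  by rewrite index_mem mem_undup; apply: image_f; apply: (valP x).
apply/existsP; exists [ffun x => Ordinal (rA x)].
apply/forallP=> x; apply/forallP=> y; apply/implyP=> exy; rewrite !ffunE.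
have /forallP/(_ (val y))/implyP/(_ exy) := pr (val x).
apply: contraNneq => -[] /(congr1 (nth (r (val x)) (undup [seq r x | x in A]))).
by rewrite !nth_index ?mem_undup ?image_f ?(valP x) ?(valP y) // => ->.
Qed.

Definition phi_col (G : sgraph) (r : G -> nat) : nat :=
  \max_(A : {set G} | A != set0) (ncolors r A - chi (induced A)).

Definition hphi_col (G : sgraph) (r : G -> nat) : nat :=
  \max_(A : {set G} | connected (induced A)) (ncolors r A - chi (induced A)).

(* [f] attains its minimum over all proper colorings of [G], and the minimum is
   [p]. Colors range over nat, so the number of colors is not bounded. *)
Definition min_over_colorings (G : sgraph) (f : (G -> nat) -> nat) (p : nat)
    : Prop :=
  (exists2 r : G -> nat, proper_coloring r & f r = p) /\
  (forall r : G -> nat, proper_coloring r -> p <= f r).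

Definition phi_eq (G : sgraph) (p : nat) : Prop :=
  min_over_colorings (@phi_col G) p.

Definition hphi_eq (G : sgraph) (p : nat) : Prop :=
  min_over_colorings (@hphi_col G) p.

(* Main.v *)
Require Import Defs.
From mathcomp Require Import all_boot zify.

Set Implicit Arguments.
Unset Strict Implicit.
Unset Printing Implicit Defensive.

(** Take the disjoint union of [p] copies of [K_p] and one [K_c] with [c > p],
    possibly making some of the vertices of [K_c] universal while keeping more
    than [p] of them nonuniversal. Under any proper coloring, a greedy choice
    picks one nonuniversal vertex in each of the [p + 1] cliques so that their
    colors are distinct; this gives an independent set with [p + 1] colors, so
    that [phi >= p]. A universal vertex added to it makes it connected and
    increases both the number of colors and the chromatic number by one, which
    gives the same bound for the connected variant. Conversely, color the small
    cliques with [0..p-1] and [K_c] with [0..c-1]: the vertices with a color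
    at least [p] form a clique, so that an induced subgraph [H] uses at most
    [p + chi H] colors. *)

(** * Proper colorings, cliques and the chromatic number *)

Lemma proper_coloringP (G : sgraph) (C : eqType) (r : G -> C) :
  reflect (forall x y, edge x y -> r x != r y) (proper_coloring r).
Proof.
apply: (iffP forallP) => [rP x y exy|rP x].
  by move: (rP x) => /forallP/(_ y); rewrite exy.
by apply/forallP => y; apply/implyP; apply: rP.
Qed.

Lemma cliqueP (G : sgraph) (K : {set G}) :
  reflect {in K &, forall x y, x != y -> edge x y} (clique K).
Proof.
apply: (iffP forall_inP) => [cK x y xK yK|cK x xK].
  by move: (cK x xK) => /forall_inP/(_ y yK)/implyP.
by apply/forall_inP => y yK; apply/implyP; apply: cK.
Qed.

Lemma chi_leq (G : sgraph) (f : G -> nat) k :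
  proper_coloring f -> (forall x, f x < k) -> chi G <= k.
Proof.
move=> /proper_coloringP fP f_lt; rewrite /chi; case: ex_minnP => n _; apply.
apply/existsP; exists [ffun x => Ordinal (f_lt x)].
by apply/proper_coloringP => x y /fP; rewrite !ffunE.
Qed.

Lemma clique_leq_chi (G : sgraph) (K : {set G}) : clique K -> #|K| <= chi G.
Proof.
move=> /cliqueP cK; rewrite /chi; case: ex_minnP => n.
case/existsP => r /proper_coloringP rP _.
rewrite -[leqRHS]card_ord -(@card_in_imset _ _ r); first exact: max_card.
move=> x y xK yK eq_r; apply/eqP; apply: contraT => /(cK _ _ xK yK)/rP.
by rewrite eq_r eqxx.
Qed.

Lemma omega_leq_chi (G : sgraph) : omega G <= chi G.
Proof. by apply/bigmax_leqP => K; apply: clique_leq_chi. Qed.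

Lemma clique_leq_chi_induced (G : sgraph) (A K : {set G}) :
  K \subset A -> clique K -> #|K| <= chi (induced A).
Proof.
move=> /subsetP sKA /cliqueP cK.
pose K' := [set x : induced A | val x \in K].
have -> : #|K| = #|K'|.
  rewrite -(card_imset K' val_inj); congr #|pred_of_set _|.
  apply/setP => x; apply/idP/imsetP => [xK|[y + ->]]; last by rewrite inE.
  by exists (Sub x (sKA x xK)); rewrite ?inE SubK.
apply: clique_leq_chi; apply/cliqueP => x y; rewrite !inE => xK yK neq.
exact: cK.
Qed.

(** * Perfection of forest comparability graphs *)

(** The condition on [k] says that [G] is the comparability graph of a rooted
    forest, [k] increasing away from the roots. *)
Definition forest_order (G : sgraph) (k : G -> nat) :=
  [/\ proper_coloring k,
      forall x y z, k x < k y < k z -> edge x y -> edge y z -> edge x z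
    & forall x y z, k x < k z -> k y < k z -> x != y ->
        edge x z -> edge y z -> edge x y].

(* Color each vertex by its depth. *)
Lemma forest_order_chi (G : sgraph) (k : G -> nat) :
  forest_order k -> chi G = omega G.
Proof.
move=> [/proper_coloringP kP ktr kdown]; apply/eqP.
rewrite eqn_leq omega_leq_chi andbT.
(* [D x] is the set of proper ancestors of [x], so [#|D x|] is its depth. *)
pose D x := [set y | edge y x & k y < k x].
have DN x : x \notin D x by rewrite inE ltnn andbF.
have D_lt x y : edge x y -> k x < k y -> #|D x| < #|D y|.
  move=> exy kxy; apply: proper_card; apply/properP; split.
    apply/subsetP => z; rewrite !inE => /andP[ezx kzx].
    by rewrite (ltn_trans kzx kxy) (ktr z x y) ?kzx.
  by exists x => //; rewrite inE exy.
apply: (@chi_leq _ (fun x => #|D x|)) => [|x].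
  apply/proper_coloringP => x y exy; rewrite neq_ltn.
  move: (kP _ _ exy); rewrite neq_ltn => /orP[] kxy; apply/orP; [left|right];
    by apply: D_lt => //; rewrite edge_sym.
(* The root path [x |: D x] is a clique, which bounds the depth strictly by [omega G]. *)
have <- : #|x |: D x| = #|D x|.+1 by rewrite cardsU1 DN.
apply: (leq_bigmax_cond (F := fun K : {set G} => #|K|)).
apply/cliqueP => y z; rewrite !inE => /predU1P[->|/andP[ey ky]]
  /predU1P[->|/andP[ez kz]] // neq; first by rewrite eqxx in neq.
- by rewrite edge_sym.
- exact: (kdown y z x).
Qed.

(** A forest order restricts to every induced subgraph. *)
Lemma forest_order_perfect (G : sgraph) (k : G -> nat) :
  forest_order k -> perfect G.
Proof.
move=> [/proper_coloringP kP ktr kdown] A _.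
apply: (@forest_order_chi (induced A) (fun x => k (val x))); split.
- by apply/proper_coloringP => x y; apply: kP.
- by move=> x y z; apply: ktr.
- by move=> x y z kx ky neq; apply: kdown.
Qed.

(** * Bounds on the number of colors of a subgraph *)

Lemma ncolors_upper (G : sgraph) (r : G -> nat) p (A : {set G}) :
  clique [set x | p <= r x] -> ncolors r A <= p + chi (induced A).
Proof.
move=> /cliqueP cK; pose K := [set x in A | p <= r x].
apply: (@leq_trans (p + #|K|)); last first.
  rewrite leq_add2l clique_leq_chi_induced //.
    by apply/subsetP => x; rewrite inE => /andP[].
  by apply/cliqueP => x y; rewrite !inE => /andP[_ px] /andP[_ py];
    apply: cK; rewrite inE.
rewrite -{1}(size_iota 0 p) -(size_image r K) -size_cat.
apply: uniq_leq_size => [|z]; first exact: undup_uniq.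
rewrite mem_undup => /imageP[x xA ->]; rewrite mem_cat mem_iota /=.
by case: ltnP => //= px; apply: image_f; rewrite inE xA.
Qed.

Lemma ncolors_inj (G : sgraph) (C : eqType) (r : G -> C) (A : {set G}) :
  {in A &, injective r} -> ncolors r A = #|A|.
Proof.
move=> rI; rewrite /ncolors undup_id ?size_image //.
rewrite map_inj_in_uniq ?enum_uniq // => x y.
by rewrite !mem_enum; apply: rI.
Qed.

(** Greedy choice: the vertices taken from the first [n] cliques block only [n] colors, while the
    clique [K n] shows more than [n]. As no edge joins distinct cliques, the selection is
    independent. *)
Lemma rainbow_transversal (G : sgraph) (C : eqType) (r : G -> C)
    (K : nat -> {set G}) n :
  proper_coloring r -> (forall i, i < n -> clique (K i) /\ i < #|K i|) ->
  (forall i j x y, i < n -> j < n -> x \in K i -> y \in K j -> edge x y ->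
    i = j) ->
  exists A : {set G}, [/\ #|A| = n, {in A &, injective r},
    {in A &, forall x y, ~~ edge x y}
    & forall x, x \in A -> exists2 i, i < n & x \in K i].
Proof.
move=> /proper_coloringP rP; elim: n => [|n IHn] cK aK.
  by exists set0; split; rewrite ?cards0 // => x; rewrite inE.
have [||A [cA rI iA sA]] := IHn.
- by move=> i i_lt; apply: cK; apply: ltnW.
- by move=> i j x y i_lt j_lt; apply: aK; apply: ltnW.
have [/cliqueP cKn ltKn] := cK n (ltnSn n).
have [x xK xr] : exists2 x, x \in K n & r x \notin [seq r y | y in A].
  apply/exists_inP; apply: contraTT ltKn; rewrite negb_exists_in -leqNgt.
  move=> /forall_inP sKr; rewrite -[leqRHS]cA -(size_image r A).
  rewrite -(size_image r (K n)); apply: uniq_leq_size => [|_ /imageP[y yK ->]].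
    rewrite map_inj_in_uniq ?enum_uniq // => y z; rewrite !mem_enum => yK zK.
    move=> eq_r; apply/eqP; apply: contraT => /(cKn _ _ yK zK)/rP.
    by rewrite eq_r eqxx.
  by move: (sKr y yK); rewrite negbK.
have rxA y : y \in A -> r x != r y.
  by move=> yA; apply: contraNneq xr => ->; apply: image_f.
have xA y : y \in A -> ~~ edge x y.
  move=> /sA[i i_lt yK]; apply/negP => exy; move: (i_lt).
  by rewrite -(aK n i x y) ?ltnn //; apply: ltnW.
exists (x |: A); split.
- rewrite cardsU1 cA; case: (boolP (x \in A)) => // /rxA.
  by rewrite eqxx.
- move=> y z; rewrite !inE => /predU1P[->|yA] /predU1P[->|zA] //.
  + by move/eqP; rewrite (negbTE (rxA z zA)).
  + by move/esym/eqP; rewrite (negbTE (rxA y yA)).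
  + exact: rI.
- move=> y z; rewrite !inE => /predU1P[->|yA] /predU1P[->|zA].
  + by rewrite edge_irrefl.
  + exact: xA.
  + by rewrite edge_sym xA.
  + exact: iA.
- move=> y; rewrite !inE => /predU1P[->|/sA[i i_lt yK]]; first by exists n.
  by exists i => //; apply: ltnW.
Qed.

Lemma phi_col_lower (G : sgraph) (r : G -> nat) p (A : {set G}) :
  #|A| = p.+1 -> {in A &, injective r} -> {in A &, forall x y, ~~ edge x y} ->
  p <= phi_col r.
Proof.
move=> cA rI iA.
have chiA : chi (induced A) <= 1.
  apply: (@chi_leq _ (fun=> 0)) => //; apply/proper_coloringP => x y.
  by rewrite /= /induced_edge (negbTE (iA _ _ (valP x) (valP y))).
have A0 : A != set0 by rewrite -card_gt0 cA.
apply: (bigmax_sup A) => //.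
by rewrite ncolors_inj // cA; lia.
Qed.

Lemma hphi_col_lower (G : sgraph) (r : G -> nat) p (A : {set G}) u :
  proper_coloring r ->
  #|A| = p.+1 -> {in A &, injective r} -> {in A &, forall x y, ~~ edge x y} ->
  {in A, forall x, edge u x} -> p <= hphi_col r.
Proof.
move=> /proper_coloringP rP cA rI iA uA; pose B := u |: A.
have uNA : u \notin A by apply/negP => /uA; rewrite edge_irrefl.
have uB : u \in B by rewrite !inE eqxx.
have chiB : chi (induced B) <= 2.
  (* [B] induces a star: its center gets color 1 and its leaves color 0, by the coercion of booleans
     to [nat]. *)
  apply: (@chi_leq (induced B) (fun x => val x == u)) => [|x]; last by case: eqP.
  apply/proper_coloringP => -[x xB] [y yB] /=; rewrite /induced_edge /=.
  move: xB yB; rewrite !inE.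
  case: (eqVneq x u) => [->|_] /= xA; case: (eqVneq y u) => [->|_] //= yA.
    by rewrite edge_irrefl.
  by rewrite (negbTE (iA _ _ xA yA)).
have rIB : {in B &, injective r}.
  move=> x y; rewrite !inE => /predU1P[->|xA] /predU1P[->|yA] //.
  - by move/eqP; rewrite (negbTE (rP _ _ (uA _ yA))).
  - by move/esym/eqP; rewrite (negbTE (rP _ _ (uA _ xA))).
  - exact: rI.
have conB : connected (induced B).
  apply/andP; split; first by apply/card_gt0P; exists (Sub u uB).
  pose v : induced B := Sub u uB.
  have toU x : connect (@edge (induced B)) v x.
    case: (eqVneq x v) => [-> //|xv]; apply: connect1.
    rewrite /= /induced_edge /=; apply: uA.
    by move: (valP x) xv; rewrite -val_eqE !inE => /predU1P[->|//]; rewrite eqxx.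
  apply/forallP => x; apply/forallP => y; apply: connect_trans (toU y).
  by rewrite (sym_connect_sym (@edge_sym _)).
apply: (bigmax_sup B) => //.
by rewrite ncolors_inj // cardsU1 uNA cA; lia.
Qed.

(** * The disjoint cliques with universal vertices *)

Section Cliques.
Variables p d c : nat.

(* [inr] is the clique [K_c], whose vertices [inr a] with [d <= a] are
   universal; these get the block number [p.+1]. *)
Notation cvert := ('I_p * 'I_p + 'I_c)%type.

Definition block (x : cvert) : nat :=
  match x with inl q => q.1 | inr a => if a < d then p else p.+1 end.

(** As block numbers stop at [p.+1], the test [p < block x] singles out the universal vertices. *)
Definition cliques_edge : rel cvert := fun x y =>
  (x != y) && [|| block x == block y, p < block x | p < block y].

Lemma cliques_edge_sym : symmetric cliques_edge.
Proof.
by move=> x y; rewrite /cliques_edge eq_sym (eq_sym (block x)) (orbC (p < _)).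
Qed.

Lemma cliques_edge_irrefl : irreflexive cliques_edge.
Proof. by move=> x; rewrite /cliques_edge eqxx. Qed.

Definition cliques : sgraph := SGraph cliques_edge_sym cliques_edge_irrefl.

Definition cliques_col (x : cliques) : nat :=
  match x with inl q => q.2 | inr a => a end.

Lemma block_inr a : p <= block (inr a).
Proof. by rewrite /=; case: ifP. Qed.

Lemma block_inl q : block (inl q) < p.
Proof. exact: ltn_ord. Qed.

Lemma block_max x : block x <= p.+1.
Proof.
by case: x => [q|a]; [apply/ltnW/ltnW/block_inl | rewrite /=; case: ifP].
Qed.

(** Only universal vertices join [K_c] to the small cliques, and their colors are at least [d],
    hence outside the palette below [p]. *)
Lemma cliques_colP (x y : cliques) : p <= d ->
  edge x y -> cliques_col x != cliques_col y.
Proof.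
move=> pd; rewrite /= /cliques_edge.
case: x y => [[i j]|a] [[i' j']|a'] /=.
- have /ltn_geF ip := ltn_ord i; have /ltn_geF ip' := ltn_ord i'.
  rewrite (ltnNge p i) (ltnNge p i') ?(ltnW (ltn_ord _)) /= orbF.
  by case/andP => neq /eqP/val_inj ii'; apply: contraNneq neq => /val_inj <-;
    rewrite ii'.
- have := ltn_ord i; have := ltn_ord j.
  by case: ifP; lia.
- have := ltn_ord i'; have := ltn_ord j'.
  by case: ifP; lia.
- by case/andP => neq _; apply: contraNneq neq => /val_inj ->.
Qed.

Lemma cliques_perfect : perfect cliques.
Proof.
(* The forest has the universal vertices as a common trunk, on which each other block is a chain.
   Reversing the order of [K_c] and shifting the small cliques by [c] puts the trunk first. *)
pose k (x : cliques) := match x with inl q => c + q.2 | inr a => c - a.+1 end.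
have kI (x y : cliques) : block x = block y -> k x = k y -> x = y.
  case: x y => [q|a] [q'|a'].
  - case: q q' => [i j] [i' j'] /= /val_inj-> /eqP.
    by rewrite eqn_add2l => /eqP/val_inj->.
  - by move=> eqb; have := block_inr a'; rewrite -eqb leqNgt block_inl.
  - by move=> eqb; have := block_inr a; rewrite eqb leqNgt block_inl.
  - move=> _ /= eq_k; congr inr; apply: val_inj => /=.
    by have := ltn_ord a; have := ltn_ord a'; lia.
(* With this, each condition of a forest order reduces to a case split on which vertices are
   universal. *)
have kU (x y : cliques) : p < block x -> block y <= p -> k x < k y.
  case: x => [q|a]; first by move=> /ltnW; rewrite leqNgt block_inl.
  case: y => [q|b] /=; have := ltn_ord a; first lia.
  by have := ltn_ord b; do 2!case: ifP; lia.
apply: (@forest_order_perfect _ k); split.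
- apply/proper_coloringP => x y /=; rewrite /cliques_edge => /andP[neq].
  move=> exy; apply: contraNneq neq => eq_k; apply/eqP; apply: kI => //.
  have := kU x y; have := kU y x; rewrite eq_k ltnn.
  by have := block_max x; have := block_max y; lia.
- move=> x y z /andP[kxy kyz] /=; rewrite /cliques_edge.
  move=> /andP[_ exy] /andP[_ eyz].
  have -> /= : x != z by apply: contraTneq (ltn_trans kxy kyz) => ->; lia.
  have := block_max x; have := block_max y; have := block_max z.
  by have := kU y x; have := kU z y; lia.
- move=> x y z kxz kyz neq /=; rewrite /cliques_edge neq /=.
  have := block_max x; have := block_max y; have := block_max z.
  by have := kU z x; have := kU z y; lia.
Qed.

Hypotheses (pd : p < d) (dc : d <= c).

Lemma cliques_col_lt (x : cliques) : cliques_col x < c.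
Proof.
case: x => [[i j]|a] /=; last exact: ltn_ord.
by have := ltn_ord j; lia.
Qed.

Lemma cliques_clique (K : {set cliques}) :
  {in K &, forall x y, [|| block x == block y, p < block x | p < block y]} ->
  clique K.
Proof.
by move=> bK; apply/cliqueP => x y xK yK neq; apply/andP; split=> //; apply: bK.
Qed.

Lemma cliques_inr_clique (K : {set cliques}) :
  {in K, forall x, p <= block x} -> clique K.
Proof.
move=> bK; apply: cliques_clique => x y /bK px /bK py; lia.
Qed.

Lemma cliques_chi : chi cliques = c.
Proof.
apply/eqP; rewrite eqn_leq; apply/andP; split.
  apply: (chi_leq _ cliques_col_lt).
  by apply/proper_coloringP => x y; apply: cliques_colP; apply: ltnW.
pose K : {set cliques} := [set inr a | a in 'I_c].
have -> : c = #|K| by rewrite card_imset ?card_ord // => a b [].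
by apply/clique_leq_chi/cliques_inr_clique => _ /imsetP[a _ ->];
  apply: block_inr.
Qed.

Lemma cliques_ncolors (A : {set cliques}) :
  ncolors cliques_col A - chi (induced A) <= p.
Proof.
rewrite leq_subLR addnC; apply: ncolors_upper.
apply: cliques_inr_clique => -[q|a]; rewrite inE => /=; last first.
  by move=> _; apply: block_inr.
by rewrite /= leqNgt ltn_ord.
Qed.

(** The cliques are the blocks [0..p]: block [i < p] has [p] vertices and block [p] has [d > p], so
    each has more vertices than its index. *)
Lemma cliques_transversal (r : cliques -> nat) :
  proper_coloring r -> exists A : {set cliques},
    [/\ #|A| = p.+1, {in A &, injective r}, {in A &, forall x y, ~~ edge x y}
      & {in A, forall x, block x <= p}].
Proof.
move=> rP; pose K i := [set x : cliques | block x == i].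
have [||A [cA rI iA sA]] := @rainbow_transversal cliques _ r K p.+1 rP.
- move=> i; rewrite ltnS => ip; split.
    apply: cliques_clique => x y; rewrite !inE => /eqP-> /eqP->.
    by rewrite eqxx.
  move: ip; rewrite leq_eqVlt => /predU1P[->|ip].
    pose f (a : 'I_d) : cliques := inr (widen_ord dc a).
    have fI : injective f by move=> a b [/val_inj].
    apply: leq_trans pd _; rewrite -[leqLHS]card_ord -(card_imset _ fI).
    apply/subset_leq_card/subsetP => _ /imsetP[a _ ->].
    by rewrite inE /= ltn_ord.
  pose f (j : 'I_p) : cliques := inl (Ordinal ip, j).
  have fI : injective f by move=> a b [].
  apply: leq_trans (ip) _; rewrite -[leqLHS]card_ord -(card_imset _ fI).
  by apply/subset_leq_card/subsetP => _ /imsetP[j _ ->]; rewrite inE.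
- move=> i j x y ip jp; rewrite !inE => /eqP bx /eqP by_ /andP[_].
  by rewrite bx by_; lia.
by exists A; split=> // x /sA[i ip]; rewrite inE => /eqP->.
Qed.

Lemma cliques_phi : phi_eq cliques p.
Proof.
have lower (r : cliques -> nat) : proper_coloring r -> p <= phi_col r.
  by move=> /cliques_transversal[A [cA rI iA _]]; apply: phi_col_lower iA.
split=> //; have colP : proper_coloring cliques_col.
  by apply/proper_coloringP => x y; apply: cliques_colP; apply: ltnW.
exists cliques_col => //; apply/eqP; rewrite eqn_leq lower // andbT.
by apply/bigmax_leqP => A _; apply: cliques_ncolors.
Qed.

Lemma cliques_hphi : d < c -> hphi_eq cliques p.
Proof.
move=> ltdc.
have lower (r : cliques -> nat) : proper_coloring r -> p <= hphi_col r.
  move=> rP; have [A [cA rI iA bA]] := cliques_transversal rP.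
  (* The vertex of [K_c] with index [d] is universal, and serves as the center of the star. *)
  apply: (@hphi_col_lower _ _ _ A (inr (Ordinal ltdc))) => // x /bA bx.
  have bu : block (inr (Ordinal ltdc)) = p.+1 by rewrite /= ltnn.
  rewrite /= /cliques_edge bu ltnSn !orbT andbT.
  by apply: contraTneq bx => <-; rewrite bu ltnn.
split=> //; have colP : proper_coloring cliques_col.
  by apply/proper_coloringP => x y; apply: cliques_colP; apply: ltnW.
exists cliques_col => //; apply/eqP; rewrite eqn_leq lower // andbT.
by apply/bigmax_leqP => A _; apply: cliques_ncolors.
Qed.

Lemma cliques_card_gt0 : 0 < #|cliques|.
Proof.
have c0 : 0 < c by lia.
by apply/card_gt0P; exists (inr (Ordinal c0)).
Qed.

End Cliques.

Theorem theorem5p4 :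
  (forall c p : nat, 1 <= c -> p <= c - 1 ->
     exists G : sgraph, [/\ 0 < #|G|, perfect G, chi G = c & phi_eq G p]) /\
  (forall c p : nat, 2 <= c -> p <= c - 2 ->
     exists G : sgraph, [/\ 0 < #|G|, perfect G, chi G = c & hphi_eq G p]).
Proof.
split=> c p c_gt p_le.
- have pc : p < c by lia.
  (* With [d = c] there is no universal vertex. *)
  exists (cliques p c c); split; first exact: cliques_card_gt0 pc _.
  + exact: cliques_perfect.
  + exact: cliques_chi.
  + exact: cliques_phi.
(* Taking [d = c.-1] leaves exactly one universal vertex; [p < d] is then the bound [p <= c - 2]. *)
- have pd : p < c.-1 by lia.
  have dc : c.-1 < c by lia.
  exists (cliques p c.-1 c); split; first exact: cliques_card_gt0 pd (ltnW dc).
  + exact: cliques_perfect.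
  + exact: cliques_chi pd (ltnW dc).
  + exact: cliques_hphi pd (ltnW dc) dc.
Qed.
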